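(* In the setting of the context (i.i.d. data from the sigmoid-gated multinomial logistic mixture of experts $p_{G^*}$, assumptions (A.1)--(A.4), $k>k^*$), the density estimator $p_{\widehat{G}_n}(Y\mid X)$ associated with the maximum likelihood estimator $\widehat{G}_n$ converges to the true density $p_{G^*}(Y\mid X)$ under the Hellinger distance at the rate $$\mathbb{E}_X\big[d_H\big(p_{\widehat{G}_n}(\cdot\mid X),p_{G^*}(\cdot\mid X)\big)\big]=\mathcal{O}_P\big(\sqrt{Kdk\log(n)/n}\big).$$
   Context: Notation. $[n]=\{1,\dots,n\}$; $\sigma(t)=1/(1+e^{-t})$. For probability mass functions $p,q$ on $[K]$, $d_H(p,q)=\big(\tfrac12\sum_{s=1}^K(\sqrt{p(s)}-\sqrt{q(s)})^2\big)^{1/2}$. For positive random sequences, $t_n=\mathcal{O}_P(s_n)$ means: for every $\epsilon>0$ there is $M>0$ with $\mathbb{P}(t_n/s_n>M)<\epsilon$ for all sufficiently large $n$. Model. Let $\Theta\subset\mathbb{R}\times\mathbb{R}^d\times\mathbb{R}\times\mathbb{R}^{d\times K}\times\mathbb{R}^K$ be the parameter space, with elements $(\gamma,\alpha,\beta,a,b)$, $a=(a_1,\dots,a_K)$ with $a_\ell\in\mathbb{R}^d$, and $b=(b_1,\dots,b_K)$. A mixing measure is $G=\sum_{i=1}^{k'}\exp(\gamma_i)\delta_{(\alpha_i,\beta_i,a_i,b_i)}$ with $(\gamma_i,\alpha_i,\beta_i,a_i,b_i)\in\Theta$; $\mathcal{G}_k(\Theta)$ is the set of all such measures with $1\le k'\le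 k$. For $s\in[K]$, $$p_G(Y=s\mid X)=\sum_{i=1}^{k'}\frac{\exp(\gamma_i)\,\sigma(\alpha_i^\top X+\beta_i)}{\sum_{j=1}^{k'}\exp(\gamma_j)\,\sigma(\alpha_j^\top X+\beta_j)}\cdot\frac{\exp(a_{is}^\top X+b_{is})}{\sum_{\ell=1}^K\exp(a_{i\ell}^\top X+b_{i\ell})}.$$ The true mixing measure is $G^*=\sum_{i=1}^{k^*}\exp(\gamma_i^* )\delta_{(\alpha_i^*,\beta_i^*,a_i^*,b_i^* )}$ with $(\gamma_i^*,\alpha_i^*,\beta_i^*,a_i^*,b_i^* )\in\Theta$. The data $(X_1,Y_1),\dots,(X_n,Y_n)\in\mathbb{R}^d\times[K]$ are i.i.d., where $Y_i$ given $X_i$ has conditional density $p_{G^*}(\cdot\mid X_i)$; $X$ takes values in the input space $\mathcal{X}\subset\mathbb{R}^d$, and $\mathbb{E}_X$ is the expectation over the distribution of $X$. The number of fitted experts is $k>k^*$; $K,d,k$ are fixed as $n\to\infty$. The MLE is any $\widehat{G}_n\in\arg\max_{G\in\mathcal{G}_k(\Theta)}\sum_{i=1}^n\log p_G(Y_i\mid X_i)$. Assumptions. (A.1) $\Theta$ is compact and $\mathcal{X}$ is bounded. (A.2) $(a_1^*,b_1^* ),\dots,(a_{k^*}^*,b_{k^*}^* )$ are distinct. (A.3) $a_{iK}^*=\mathbf{0}_d$ and $b_{iK}^*=0$ for all $i\in[k^*]$, and $\gamma_{k^*}^*=0$. (A.4) At least one of $\alpha_1^*,\dots,\alpha_{k^*}^*$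 is non-zero. *)

(* Defs.v *)
From HB Require Import structures.
From mathcomp Require Import all_boot all_order all_algebra.
From mathcomp Require Import all_classical all_reals all_analysis.

Set Implicit Arguments.
Unset Strict Implicit.
Unset Printing Implicit Defensive.

Import Order.TTheory GRing.Theory Num.Theory.
Import numFieldNormedType.Exports.

Local Open Scope classical_set_scope.
Local Open Scope ring_scope.

(* The labels 1, ..., K are the ordinals of 'I_K with K = K'.+1 (so that [K] is
   nonempty, as MathComp's pointed types require); the K-th label is ord_max. *)
HB.instance Definition _ (n : nat) := isPointed.Build 'I_n.+1 ord0.
HB.instance Definition _ (n : nat) := @isMeasurable.Build
  default_measure_display 'I_n.+1 discrete_measurable discrete_measurable0
  discrete_measurableC discrete_measurableU.

(* R^d with its Borel sigma-algebra *)
Notation borel_cV R d := (g_sigma_algebraType (@open 'cV[R]_d)).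

Section model.
Context {R : realType} {d K' : nat}.
Local Notation K := K'.+1.

Definition dotv (u v : 'cV[R]_d) : R := (u^T *m v) ord0 ord0.

Definition sigmoid (t : R) : R := 1 / (1 + expR (- t)).

(* (gamma, alpha, beta, a, b), where a_l is the l-th column of a *)
Definition param : Type := (R * 'cV[R]_d * R * 'M[R]_(d, K) * 'cV[R]_K)%type.

Definition gamma (t : param) : R := t.1.1.1.1.
Definition alpha (t : param) : 'cV[R]_d := t.1.1.1.2.
Definition beta (t : param) : R := t.1.1.2.
Definition expert_a (t : param) : 'M[R]_(d, K) := t.1.2.
Definition expert_b (t : param) : 'cV[R]_K := t.2.

(* The mixing measure sum_i exp(gamma_i) delta_(alpha_i, beta_i, a_i, b_i) is
   represented by the list of its (gamma_i, alpha_i, beta_i, a_i, b_i). Two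
   lists describing the same measure have the same cond_density below, since
   the latter only involves the total weight exp(gamma_i) put on each atom. *)
Definition mixing := seq param.

Definition mixing_class (k : nat) (Theta : set param) : set mixing :=
  [set G | (1 <= size G <= k)%N /\ forall t, t \in G -> Theta t].

Definition gate_weight (t : param) (x : 'cV[R]_d) : R :=
  expR (gamma t) * sigmoid (dotv (alpha t) x + beta t).

Definition expert_score (t : param) (x : 'cV[R]_d) (s : 'I_K) : R :=
  expR (dotv (col s (expert_a t)) x + expert_b t s ord0).

Definition cond_density (G : mixing) (x : 'cV[R]_d) (s : 'I_K) : R :=
  \sum_(t <- G) gate_weight t x / (\sum_(u <- G) gate_weight u x)
              * (expert_score t x s / \sum_(l < K) expert_score t x l).

Definition hellinger (p q : 'I_K -> R) : R :=
  Num.sqrt (2^-1 * \sum_(s < K) (Num.sqrt (p s) - Num.sqrt (q s)) ^+ 2).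

Definition log_likelihood (n : nat) (z : nat -> 'cV[R]_d * 'I_K)
    (G : mixing) : R :=
  \sum_(i < n) ln (cond_density G (z i).1 (z i).2).

Definition is_mle (k : nat) (Theta : set param) (n : nat)
    (z : nat -> 'cV[R]_d * 'I_K) (G : mixing) : Prop :=
  mixing_class k Theta G /\
  forall G', mixing_class k Theta G' ->
    log_likelihood n z G' <= log_likelihood n z G.

Definition expected_hellinger (mu : probability (borel_cV R d) R)
    (G1 G2 : mixing) : R :=
  (\int[mu]_x hellinger (cond_density G1 x) (cond_density G2 x))%R.

End model.

Arguments param : clear implicits.
Arguments mixing : clear implicits.

Section probability.
Context {R : realType} {dO : measure_display} {Omega : measurableType dO}.
Variable P : probability Omega R.

Definition mutually_independent {dT : measure_display} {T : measurableType dT}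
    (Z : nat -> Omega -> T) : Prop :=
  forall (J : seq nat) (B : nat -> set T), uniq J ->
    (forall j, measurable (B j)) ->
    P (\big[setI/setT]_(j <- J) (Z j @^-1` B j)) =
      (\prod_(j <- J) P (Z j @^-1` B j))%E.

(* (X, Y) = Z, where X has law mu and p x is the conditional probability mass
   function of Y given X = x *)
Definition has_law {d K' : nat} (mu : probability (borel_cV R d) R)
    (p : 'cV[R]_d -> 'I_K'.+1 -> R)
    (Z : Omega -> (borel_cV R d * 'I_K'.+1)%type) : Prop :=
  (forall A : set (borel_cV R d), measurable A ->
     P [set w | A (Z w).1] = mu A) /\
  (forall (A : set (borel_cV R d)) (s : 'I_K'.+1), measurable A ->
     P [set w | A (Z w).1 /\ (Z w).2 = s] = (\int[mu]_(x in A) (p x s)%:E)%E).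

(* P^* is the outer measure of P. It coincides with P on measurable sets; it is
   used because a pointwise maximiser of the likelihood need not be a
   measurable function on Omega. *)
Definition bigO_P (t : nat -> Omega -> R) (s : nat -> R) : Prop :=
  forall eps : R, 0 < eps -> exists2 M : R, 0 < M &
    \forall n \near \oo, ((P^*)%mu [set w | M < t n w / s n]%R < eps%:E)%E.

End probability.

(* Main.v *)
(** The class of mixtures of size at most [k] with parameters in the compact
    [Theta] has, for every [n], a net of cardinality polynomial in [n] such that
    every density of the class is within a factor [exp (l / n)] of a density of
    the net, uniformly in the covariate.  Replacing the MLE by its neighbour in
    the net thus changes the log-likelihood by at most [l] and the squared
    Hellinger distance by at most [l / (2 n)].  For a fixed element [H] of the
    net, Chernoff's bound at exponent 1/2 shows that the log-likelihood of [H]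
    exceeds that of the truth minus [l] with probability at most
    [exp (l / 2 - n h^2)], [h^2] being the mean squared Hellinger distance.
    A union bound over the elements of the net with [h^2 > (D + 1) ln n / n]
    yields the rate, since [E h <= (E h^2 / r + r) / 2] for every [r > 0]. *)
Require Import Defs.
From HB Require Import structures.
From mathcomp Require Import all_boot all_order all_algebra.
From mathcomp Require Import all_classical all_reals all_analysis.
From mathcomp Require Import measurable_realfun.
From mathcomp Require Import ring lra.

Set Implicit Arguments.
Unset Strict Implicit.
Unset Printing Implicit Defensive.

Import Order.TTheory GRing.Theory Num.Theory.
Import numFieldNormedType.Exports.
Import HBNNSimple.

Local Open Scope classical_set_scope.
Local Open Scope ring_scope.

(** * Integrals and independence *)

Section weighted.
Local Open Scope ereal_scope.

(** Monotone convergence along simple functions increasing to [f]. The resulting limit involves [m],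
    [w] and [X] only through the integrals of [w] over preimages under [X], so it can be compared
    across spaces. *)
Lemma integral_comp_weight d1 (T1 : measurableType d1) d (T : measurableType d)
    (R : realType) (m : {measure set T1 -> \bar R}) (w : T1 -> R)
    (X : T1 -> T) (f : T -> R) (mf : measurable_fun [set: T] (EFin \o f)) :
  measurable_fun [set: T1] w -> (forall x, 0 <= w x)%R -> measurable_fun [set: T1] X ->
  (forall t, 0 <= f t)%R ->
  \int[m]_x (f (X x) * w x)%:E =
    limn (fun n => \sum_(v \in range (nnsfun_approx measurableT mf n))
      (v%:E * \int[m]_(x in
         X @^-1` (nnsfun_approx measurableT mf n @^-1` [set v])) (w x)%:E)).
Proof.
move=> mw w0 mX f0; set h := nnsfun_approx measurableT mf.
have f0' t : [set: T] t -> 0 <= (EFin \o f) t by move=> _; rewrite lee_fin.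
have fXE x : (f (X x) * w x)%:E = limn (fun n => (h n (X x))%:E * (w x)%:E).
  apply/esym/cvg_lim => //; rewrite EFinM; apply: cvgeZr => //.
  exact: (cvg_nnsfun_approx measurableT mf f0' (x := X x) I).
have mhX n : measurable_fun setT (fun x => h n (X x)).
  by apply: (measurableT_comp (f := h n)).
under eq_integral do rewrite fXE.
rewrite monotone_convergence //; last 3 first.
- move=> n; under eq_fun do rewrite -EFinM.
  by apply/measurable_EFinP; exact: measurable_funM.
- by move=> n x _; rewrite -EFinM lee_fin mulr_ge0.
- move=> x _ a b ab; rewrite -!EFinM lee_fin ler_wpM2r//.
  exact/lefP/nd_nnsfun_approx.
congr (limn _); apply/funext => n.
(* A simple function is the finite sum of its values times the indicators of its level sets. *)
have hE x : (h n (X x))%:E * (w x)%:E =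
    \sum_(v \in range (h n)) (v * \1_(h n @^-1` [set v]) (X x))%:E * (w x)%:E.
  rewrite (fimfunE (h n) (X x)) -fsumEFin// ge0_mule_fsuml// => v.
  exact: nnfun_muleindic_ge0.
under eq_integral do rewrite hE.
have mpre r : measurable (X @^-1` (h n @^-1` [set r])).
  by rewrite -[X in measurable X]setTI; apply: mX.
have mind r : measurable_fun [set: T1] (fun x => \1_(h n @^-1` [set r]) (X x) : R).
  by apply: measurableT_comp mX; exact: measurable_indic.
rewrite ge0_integral_fsum//; last 2 first.
- move=> y; under eq_fun do rewrite -EFinM.
  by apply/measurable_EFinP; apply: measurable_funM => //; apply: measurable_funM.
- by move=> r x _; rewrite -EFinM lee_fin mulr_ge0 // -lee_fin nnfun_muleindic_ge0.
apply: eq_fsbigr => r /[!inE] -[t _ <-].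
under eq_integral do rewrite EFinM -muleA.
rewrite ge0_integralZl//.
- congr (_ * _); rewrite [RHS]integral_mkcond; apply: eq_integral => x _.
  by rewrite epatch_indic muleC.
- under eq_fun do rewrite -EFinM.
  by apply/measurable_EFinP; apply: measurable_funM.
- by move=> x _; rewrite mule_ge0// lee_fin.
- by rewrite lee_fin.
Qed.

(** The condition on preimages says that the measures of density [w1] and [w2] have the same image
    on [T]; the formula of [integral_comp_weight] then agrees term by term. *)
Lemma eq_integral_comp_weight (R : realType) d (T : measurableType d)
    d1 (T1 : measurableType d1) (m1 : {measure set T1 -> \bar R})
    (w1 : T1 -> R) (X1 : T1 -> T)
    d2 (T2 : measurableType d2) (m2 : {measure set T2 -> \bar R})
    (w2 : T2 -> R) (X2 : T2 -> T) (f : T -> R) :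
  measurable_fun [set: T1] w1 -> (forall x, 0 <= w1 x)%R ->
  measurable_fun [set: T1] X1 ->
  measurable_fun [set: T2] w2 -> (forall x, 0 <= w2 x)%R ->
  measurable_fun [set: T2] X2 ->
  (forall A, measurable A ->
    \int[m1]_(x in X1 @^-1` A) (w1 x)%:E = \int[m2]_(x in X2 @^-1` A) (w2 x)%:E) ->
  measurable_fun [set: T] f -> (forall t, 0 <= f t)%R ->
  \int[m1]_x (f (X1 x) * w1 x)%:E = \int[m2]_x (f (X2 x) * w2 x)%:E.
Proof.
move=> mw1 w10 mX1 mw2 w20 mX2 eqw mf f0.
have mf' : measurable_fun [set: T] (EFin \o f) by exact/measurable_EFinP.
rewrite (integral_comp_weight _ mf')// (integral_comp_weight _ mf')//.
congr (limn _); apply/funext => n; apply: eq_fsbigr => r _.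
by rewrite eqw.
Qed.
End weighted.

Section independence.
Local Open Scope ereal_scope.

Lemma probability_bigsetI (R : realType) dO (Omega : measurableType dO)
    (P : probability Omega R) d (T : measurableType d)
    (Z : nat -> {RV P >-> T}) (J : seq nat) (B : nat -> set T) :
  mutually_independent P Z -> uniq J -> (forall j, measurable (B j)) ->
  \int[P]_w (\prod_(j <- J) \1_(B j) (Z j w))%R%:E = \prod_(j <- J) P (Z j @^-1` B j).
Proof.
move=> indep uJ mB; rewrite -indep//.
rewrite -[in RHS](setIT (\big[_/_]_(j <- J) _)) -integral_indic//; last first.
  apply: bigsetI_measurable => j _.
  exact: measurable_funPTI.
apply: eq_integral => w _; congr EFin.
elim: J {uJ} => [|j J IH]; first by rewrite !big_nil indicE in_setT.
by rewrite !big_cons IH indicI.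
Qed.

(* Indicators are replaced by functions one variable at a time: [J1] lists the
   variables already treated, [J2] the remaining ones. *)
Lemma expectation_prod_independent_indic (R : realType) dO (Omega : measurableType dO)
    (P : probability Omega R) d (T : measurableType d)
    (Z : nat -> {RV P >-> T}) (f : nat -> T -> R) (J1 J2 : seq nat)
    (B : nat -> set T) :
  mutually_independent P Z -> uniq (J1 ++ J2) ->
  (forall j, measurable (B j)) ->
  (forall j, measurable_fun [set: T] (f j)) ->
  (forall j t, 0 <= f j t)%R ->
  (forall j, \int[P]_w (f j (Z j w))%:E < +oo) ->
  \int[P]_w (\prod_(j <- J1) f j (Z j w) * \prod_(j <- J2) \1_(B j) (Z j w))%R%:E =
    \prod_(j <- J1) \int[P]_w (f j (Z j w))%:E * \prod_(j <- J2) P (Z j @^-1` B j).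
Proof.
move=> indep + + mf f0 foo.
have mZ j : measurable_fun [set: Omega] (Z j) by exact: measurable_funPT.
elim: J1 J2 B => [|i J1 IH] J2 B /= uJ mB.
  under eq_integral do rewrite big_nil mul1r.
  by rewrite big_nil mul1e; exact: probability_bigsetI.
move: uJ => /andP[iJ uJ].
pose W w := (\prod_(j <- J1) f j (Z j w) * \prod_(j <- J2) \1_(B j) (Z j w))%R.
have W0 w : (0 <= W w)%R by rewrite mulr_ge0//; apply: prodr_ge0.
have mW : measurable_fun [set: Omega] W.
  apply: measurable_funM; apply: measurable_prod => j _.
    exact: measurableT_comp (mZ j).
  by apply: measurableT_comp (mZ j); exact: measurable_indic.
pose c := \prod_(j <- J1) \int[P]_w (f j (Z j w))%:E * \prod_(j <- J2) P (Z j @^-1` B j).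
have ffin j : \int[P]_w (f j (Z j w))%:E \is a fin_num.
  by rewrite ge0_fin_numE// integral_ge0// => w _; rewrite lee_fin.
have c0 : 0 <= c.
  apply: mule_ge0; apply: prode_ge0 => // j _.
  by apply: integral_ge0 => w _; rewrite lee_fin.
have cfin : c \is a fin_num.
  apply: fin_numM; apply: prode_fin_num => // j _.
  by rewrite fin_num_measure//; exact: measurable_funPTI.
transitivity (\int[P]_w (f i (Z i w) * W w)%R%:E).
  by apply: eq_integral => w _; rewrite big_cons /W mulrA.
(* The random weight [W] is traded for the constant [c]: it suffices that both have the same
   integral over every preimage under [Z i]. *)
rewrite (@eq_integral_comp_weight _ _ _ _ _ P W (Z i) _ _ P (cst (fine c)) (Z i))//.
- rewrite big_cons -muleA -/c.
  under eq_integral do rewrite EFinM fineK//.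
  rewrite ge0_integralZr//; last by move=> w _; rewrite lee_fin.
  by apply/measurable_EFinP; exact: measurableT_comp (mZ i).
- by move=> w; rewrite fine_ge0.
- move=> A mA.
  have mZA : measurable (Z i @^-1` A) by exact: measurable_funPTI.
  transitivity (c * P (Z i @^-1` A)); last by rewrite -integral_cst//= fineK.
  rewrite /c -muleA.
  (* The induction hypothesis is used with [i] moved to the list of indicators. Its set is reset to
     [A]; the sets of [J2] do not change since [i] is not in [J2]. *)
  pose B' j := if j == i then A else B j.
  have uJ' : uniq (J1 ++ i :: J2).
    by rewrite -cat1s uniq_catCA cat1s /= iJ.
  have mB' j : measurable (B' j) by rewrite /B'; case: eqP.
  have B'E j : j \in J2 -> B' j = B j.
    move=> jJ2; rewrite /B'; case: eqP => // ji; move: iJ.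
    by rewrite mem_cat -ji jJ2 orbT.
  have := IH _ _ uJ' mB'; rewrite !big_cons /B' eqxx => IH'.
  have -> : \prod_(j <- J2) P (Z j @^-1` B j) = \prod_(j <- J2) P (Z j @^-1` B' j).
    by apply: eq_big_seq => j /B'E ->.
  rewrite [X in _ = _ * X]muleC -IH' [LHS]integral_mkcond.
  apply: eq_integral => w _; rewrite epatch_indic/= -EFinM; congr EFin.
  rewrite /W -mulrA big_cons eqxx; congr (_ * _)%R; rewrite mulrC; congr (_ * _)%R.
  by apply: eq_big_seq => j /B'E; rewrite /B' => ->.
Qed.

Lemma expectation_prod_independent (R : realType) dO (Omega : measurableType dO)
    (P : probability Omega R) d (T : measurableType d)
    (Z : nat -> {RV P >-> T}) (f : nat -> T -> R) (J : seq nat) :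
  mutually_independent P Z -> uniq J ->
  (forall j, measurable_fun [set: T] (f j)) ->
  (forall j t, 0 <= f j t)%R ->
  (forall j, \int[P]_w (f j (Z j w))%:E < +oo) ->
  \int[P]_w (\prod_(j <- J) f j (Z j w))%R%:E =
    \prod_(j <- J) \int[P]_w (f j (Z j w))%:E.
Proof.
move=> indep uJ mf f0 foo.
have := @expectation_prod_independent_indic _ _ _ _ _ _ Z f J [::] (fun=> set0) indep.
rewrite cats0 big_nil mule1 => <- //.
by apply: eq_integral => w _; rewrite big_nil mulr1.
Qed.
End independence.

(** * Expectations under the joint law of covariate and label *)

Section law.
Context {R : realType} {d K' : nat}.

(** Labels form a finite discrete space, so [f] is a finite sum of its sections, each times the
    indicator of its label. *)
Lemma measurable_fun_snd_ord d1 (T : measurableType d1) (f : (T * 'I_K'.+1)%type -> R) :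
  (forall s, measurable_fun [set: T] (fun x => f (x, s))) ->
  measurable_fun [set: (T * 'I_K'.+1)%type] f.
Proof.
move=> mf; have -> : f = fun z => \sum_(s < K'.+1) f (z.1, s) * \1_[set s] z.2.
  apply/funext => -[x s] /=; rewrite (bigD1 s)//= indicE mem_set// mulr1 big1 ?addr0//.
  by move=> s' s's; rewrite indicE memNset ?mulr0// => ss'; rewrite ss' eqxx in s's.
apply: measurable_sum => s; apply: measurable_funM.
  by apply: (measurableT_comp (mf s)); exact: measurable_fst.
by apply: (measurableT_comp (measurable_indic _)); [|exact: measurable_snd].
Qed.

(** The expectation is cut along the label. By [has_law], the event that the label is [s], seen
    through the covariate, has density [p x s] against [mu], so [eq_integral_comp_weight] applies
    with the indicator of that event as weight. *)
Lemma expectation_has_law dO (Omega : measurableType dO) (P : probability Omega R)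
    (mu : probability (borel_cV R d) R) (p : 'cV[R]_d -> 'I_K'.+1 -> R)
    (Z : {RV P >-> (borel_cV R d * 'I_K'.+1)%type})
    (f : (borel_cV R d * 'I_K'.+1)%type -> R) :
  has_law P mu p Z ->
  (forall s, measurable_fun [set: borel_cV R d] (p ^~ s)) ->
  (forall x s, 0 <= p x s) ->
  (forall s, measurable_fun [set: borel_cV R d] (fun x => f (x, s))) ->
  (forall z, 0 <= f z) ->
  (\int[P]_w (f (Z w))%:E = \int[mu]_x (\sum_s f (x, s) * p x s)%:E)%E.
Proof.
move=> [_ lawZ] mp p0 mf f0.
have mZ : measurable_fun [set: Omega] Z by exact: measurable_funPT.
have mZ1 : measurable_fun [set: Omega] (fun w => (Z w).1).
  exact: (measurableT_comp measurable_fst).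
have mZ2 : measurable_fun [set: Omega] (fun w => (Z w).2).
  exact: (measurableT_comp measurable_snd).
pose w1 s w : R := \1_[set s] (Z w).2.
have mw1 s : measurable_fun [set: Omega] (w1 s).
  by apply: (measurableT_comp (measurable_indic _)).
transitivity (\int[P]_w (\sum_s (f ((Z w).1, s) * w1 s w)%:E))%E.
  apply: eq_integral => w _; rewrite sumEFin; congr EFin.
  rewrite (bigD1 (Z w).2)//= /w1 indicE mem_set// mulr1 big1 ?addr0 -?surjective_pairing//.
  by move=> s' s's; rewrite indicE memNset ?mulr0// => ss'; rewrite ss' eqxx in s's.
rewrite ge0_integral_sum//; last 2 first.
- move=> s; apply/measurable_EFinP; apply: measurable_funM => //.
  exact: (measurableT_comp (mf s)).
- by move=> s w _; rewrite lee_fin mulr_ge0.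
under [RHS]eq_integral do rewrite -sumEFin.
rewrite ge0_integral_sum//; last 2 first.
- by move=> s; apply/measurable_EFinP; exact: measurable_funM.
- by move=> s w _; rewrite lee_fin mulr_ge0.
apply: eq_bigr => s _.
apply: (@eq_integral_comp_weight _ _ _ _ _ P (w1 s) (fun w => (Z w).1)
  _ _ mu (p ^~ s) id (fun x => f (x, s))) => //.
move=> A mA; rewrite -lawZ// /w1.
have mZA : measurable ((fun w => (Z w).1) @^-1` A).
  by rewrite -[X in measurable X]setTI; exact: mZ1.
have mZs : measurable ((fun w => (Z w).2) @^-1` [set s]).
  by rewrite -[X in measurable X]setTI; exact: mZ2.
by rewrite [LHS](_ : _ = \int[P]_(w in (fun w => (Z w).1) @^-1` A)
  (\1_((fun w => (Z w).2) @^-1` [set s]) w)%:E)%E// integral_indic// setIC.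
Qed.
End law.

(** * The model *)

Section model_measurability.
Context {R : realType} {d K' : nat}.

Lemma continuous_measurable_borel (f : 'cV[R]_d -> R) :
  continuous f -> measurable_fun [set: borel_cV R d] f.
Proof.
move=> /continuousP cf; apply: (measurability _ (RGenOpens.measurableE R)).
move=> _ [_ [a [b ->] <-]]; rewrite setTI; apply: sub_sigma_algebra.
exact/cf/interval_open.
Qed.

Lemma measurable_dotv (u : 'cV[R]_d) : measurable_fun [set: borel_cV R d] (dotv u).
Proof.
have -> : dotv u = fun x => \sum_i u i ord0 * x i ord0.
  by apply/funext => x; rewrite /dotv mxE; apply: eq_bigr => i _; rewrite mxE.
apply: measurable_sum => i; apply: measurable_funM => //.
by apply: continuous_measurable_borel; exact: coord_continuous.
Qed.

(** On positive reals inversion is the power of exponent -1, which is measurable. *)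
Lemma measurable_funV_gt0 d1 (T : measurableType d1) (f : T -> R) :
  (forall x, 0 < f x) -> measurable_fun [set: T] f ->
  measurable_fun [set: T] (fun x => (f x)^-1).
Proof.
move=> f0 mf; have -> : (fun x => (f x)^-1) = (fun y => y `^ (-1)) \o f.
  by apply/funext => x /=; rewrite powR_inv1// ltW.
by apply: measurableT_comp => //; exact: measurable_powR.
Qed.

Lemma sigmoid_gt0 (t : R) : 0 < sigmoid t.
Proof. by rewrite /sigmoid divr_gt0 // addr_gt0 // expR_gt0. Qed.

Lemma gate_weight_gt0 (t : param R d K') x : 0 < gate_weight t x.
Proof. by rewrite mulr_gt0 ?expR_gt0 ?sigmoid_gt0. Qed.

Lemma expert_score_gt0 (t : param R d K') x s : 0 < expert_score t x s.
Proof. exact: expR_gt0. Qed.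

Lemma sum_gate_weight_gt0 (G : mixing R d K') x :
  (0 < size G)%N -> 0 < \sum_(u <- G) gate_weight u x.
Proof.
case: G => // t G _; rewrite big_cons ltr_pwDl ?gate_weight_gt0//.
by apply: sumr_ge0 => u _; rewrite ltW ?gate_weight_gt0.
Qed.

Lemma sum_expert_score_gt0 (t : param R d K') x :
  0 < \sum_(l < K'.+1) expert_score t x l.
Proof.
rewrite big_ord_recl ltr_pwDl ?expert_score_gt0//.
by apply: sumr_ge0 => l _; rewrite ltW ?expert_score_gt0.
Qed.

Lemma cond_density_gt0 (G : mixing R d K') x s :
  (0 < size G)%N -> 0 < cond_density G x s.
Proof.
move=> G0; have c0 := sum_gate_weight_gt0 x G0.
rewrite /cond_density; set c := \sum_(u <- G) _ in c0 *.
have t0 t : 0 < gate_weight t x / c * (expert_score t x s / \sum_(l < K'.+1) expert_score t x l).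
  by rewrite mulr_gt0 ?divr_gt0 ?gate_weight_gt0 ?expert_score_gt0 ?sum_expert_score_gt0.
case: G G0 {c0} c t0 => // t G _ c t0; rewrite big_cons ltr_pwDl//.
by apply: sumr_ge0 => u _; rewrite ltW.
Qed.

Lemma sum_cond_density (G : mixing R d K') x :
  (0 < size G)%N -> \sum_s cond_density G x s = 1.
Proof.
move=> G0; rewrite exchange_big /=.
rewrite (eq_bigr (fun t => gate_weight t x / \sum_(u <- G) gate_weight u x)).
  by rewrite -mulr_suml divff// gt_eqF// sum_gate_weight_gt0.
move=> t _; rewrite -mulr_sumr -mulr_suml divff ?mulr1//.
by rewrite gt_eqF// sum_expert_score_gt0.
Qed.

Lemma measurable_gate_weight (t : param R d K') :
  measurable_fun [set: borel_cV R d] (gate_weight t).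
Proof.
apply: measurable_funM => //; rewrite /sigmoid.
apply: measurable_funM => //; apply: measurable_funV_gt0.
  by move=> x; rewrite addr_gt0// expR_gt0.
apply: measurable_funD => //; apply: measurableT_comp => //.
apply: measurable_funN => //; apply: measurable_funD => //.
exact: measurable_dotv.
Qed.

Lemma measurable_expert_score (t : param R d K') s :
  measurable_fun [set: borel_cV R d] (expert_score t ^~ s).
Proof.
apply: measurableT_comp => //; apply: measurable_funD => //.
exact: measurable_dotv.
Qed.

Lemma measurable_cond_density (G : mixing R d K') s : (0 < size G)%N ->
  measurable_fun [set: borel_cV R d] (cond_density G ^~ s).
Proof.
move=> G0; apply: measurable_sum => t; apply: measurable_funM.
  apply: measurable_funM; first exact: measurable_gate_weight.
  apply: measurable_funV_gt0; first by move=> x; exact: sum_gate_weight_gt0.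
  by apply: measurable_sum => u; exact: measurable_gate_weight.
apply: measurable_funM; first exact: measurable_expert_score.
apply: measurable_funV_gt0; first by move=> x; exact: sum_expert_score_gt0.
by apply: measurable_sum => u; exact: measurable_expert_score.
Qed.

End model_measurability.

(** * Hellinger distance and Bhattacharyya affinity *)

Section hellinger.
Context {R : realType} {K' : nat}.
Implicit Types p q : 'I_K'.+1 -> R.

(** Expand the squares. The sum on the right is the Bhattacharyya affinity, the quantity that
    Chernoff's bound at exponent 1/2 produces. *)
Lemma hellinger_sqr p q : (forall s, 0 <= p s) -> (forall s, 0 <= q s) ->
  \sum_s p s = 1 -> \sum_s q s = 1 ->
  hellinger p q ^+ 2 = 1 - \sum_s Num.sqrt (p s * q s).
Proof.
move=> p0 q0 p1 q1; rewrite /hellinger sqr_sqrtr; last first.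
  by rewrite mulr_ge0 ?invr_ge0// sumr_ge0// => s _; exact: sqr_ge0.
rewrite (eq_bigr (fun s => p s + q s - 2 * Num.sqrt (p s * q s))); last first.
  by move=> s _; rewrite sqrtrM// sqrrB !sqr_sqrtr// -mulr_natl; ring.
rewrite sumrB big_split /= p1 q1 -mulr_sumr.
by field.
Qed.

Lemma hellinger_ge0 p q : 0 <= hellinger p q.
Proof. exact: sqrtr_ge0. Qed.

Lemma hellinger_le1 p q : (forall s, 0 <= p s) -> (forall s, 0 <= q s) ->
  \sum_s p s = 1 -> \sum_s q s = 1 -> hellinger p q <= 1.
Proof.
move=> p0 q0 p1 q1; rewrite -(@ler_pXn2r _ 2)// ?nnegrE ?hellinger_ge0//.
by rewrite expr1n hellinger_sqr// gerBl sumr_ge0// => s _; exact: sqrtr_ge0.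
Qed.

(** Let [A] and [A'] be the affinities of [p] and [p'] with [q]. Then [A' <= exp (c / 2) A], hence
    [A >= (1 - c / 2) A' >= A' - c / 2], the last step because [A' <= 1]. *)
Lemma hellinger_sqr_perturb (c : R) p p' q :
  (forall s, 0 <= p s) -> (forall s, 0 <= p' s) -> (forall s, 0 <= q s) ->
  \sum_s p s = 1 -> \sum_s p' s = 1 -> \sum_s q s = 1 -> 0 <= c ->
  (forall s, p' s <= expR c * p s) ->
  hellinger p q ^+ 2 <= c / 2 + hellinger p' q ^+ 2.
Proof.
move=> p0 p'0 q0 p1 p'1 q1 c0 p'p.
have := sqr_ge0 (hellinger p' q); rewrite !hellinger_sqr// subr_ge0 => A'1.
have : \sum_s Num.sqrt (p' s * q s) <= expR (c / 2) * \sum_s Num.sqrt (p s * q s).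
  rewrite mulr_sumr; apply: ler_sum => s _.
  have -> : expR (c / 2) = Num.sqrt (expR c).
    by rewrite {2}[c]splitr expRD -expr2 sqrtr_sqr ger0_norm// expR_ge0.
  rewrite -sqrtrM ?expR_ge0// ler_wsqrtr// mulrA.
  by rewrite ler_wpM2r.
move: A'1; set A' := \sum_s _; set A := \sum_s _ => A'1 A'A.
have A0 : 0 <= A by apply: sumr_ge0 => s _; exact: sqrtr_ge0.
have A'0 : 0 <= A' by apply: sumr_ge0 => s _; exact: sqrtr_ge0.
have : expR (- (c / 2)) * A' <= A.
  by rewrite expRN mulrC ler_pdivrMr ?expR_gt0// mulrC.
have := expR_ge1Dx (- (c / 2)); move: (expR _) => e He Ae.
nra.
Qed.
End hellinger.

(** * Multiplicative stability of the density in its parameters *)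

Section parameter_perturbation.
Context {R : realType} {d K' : nat}.

(** Closeness is boolean so that it can serve as a relation for [all2] and [poly_cover]. *)
Definition mx_near m n (eps : R) (A B : 'M[R]_(m, n)) :=
  [forall i, forall j, `|A i j - B i j| <= eps].

Definition param_near (eps : R) (t u : param R d K') :=
  [&& `|gamma t - gamma u| <= eps, mx_near eps (alpha t) (alpha u),
      `|beta t - beta u| <= eps, mx_near eps (expert_a t) (expert_a u) &
      mx_near eps (expert_b t) (expert_b u)].

Lemma dotv_near (eps B : R) (u v x : 'cV[R]_d) :
  (forall i, `|u i ord0 - v i ord0| <= eps) -> (forall i, `|x i ord0| <= B) ->
  `|dotv u x - dotv v x| <= eps * B *+ d.
Proof.
move=> uv xB; rewrite /dotv !mxE -sumrB.
apply: le_trans (ler_norm_sum _ _ _) _.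
rewrite -[X in _ *+ X]card_ord -sumr_const; apply: ler_sum => i _.
by rewrite !mxE -mulrBl normrM ler_pM.
Qed.

Lemma expR_near (c x y : R) : `|x - y| <= c -> expR x <= expR c * expR y.
Proof. by rewrite ler_norml => /andP[_ xy]; rewrite -expRD ler_expR -lerBlDr. Qed.

(** The logarithm of the sigmoid is 1-Lipschitz: [1 + exp (- y) <= exp c (1 + exp (- x))] holds
    summand by summand. *)
Lemma sigmoid_near (c x y : R) : `|x - y| <= c ->
  sigmoid x <= expR c * sigmoid y.
Proof.
move=> xy; have c0 : 0 <= c by apply: le_trans xy.
have e0 z : 0 < 1 + expR z :> R by rewrite addr_gt0 ?expR_gt0.
rewrite /sigmoid !div1r ler_pdivlMr// mulrC ler_pdivrMr//.
rewrite mulrDr mulr1 lerD//.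
  by rewrite -expR0 ler_expR.
by apply: expR_near; rewrite opprK addrC.
Qed.

Lemma gate_weight_near (eps B : R) (t u : param R d K') (x : 'cV[R]_d) :
  param_near eps t u -> (forall i, `|x i ord0| <= B) ->
  gate_weight t x <= expR (eps * (2 + B *+ d)) * gate_weight u x.
Proof.
move=> /and5P[tu_g /forallP tu_a tu_b _ _] xB; rewrite /gate_weight.
(* One [eps] comes from [gamma], one from [beta], and [eps B d] from the [d] coordinates of
   [alpha]. *)
have -> : eps * (2 + B *+ d) = eps + (eps * B *+ d + eps).
  by rewrite mulrDr -mulrnAr; ring.
rewrite expRD mulrACA ler_pM ?expR_ge0 ?(ltW (sigmoid_gt0 _))//.
  exact: expR_near.
apply: sigmoid_near; rewrite opprD addrACA.
apply: le_trans (ler_normD _ _) _; rewrite lerD//.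
by apply: dotv_near => // i; move: (tu_a i) => /forallP.
Qed.

Lemma expert_score_near (eps B : R) (t u : param R d K') (x : 'cV[R]_d) s :
  param_near eps t u -> (forall i, `|x i ord0| <= B) ->
  expert_score t x s <= expR (eps * (1 + B *+ d)) * expert_score u x s.
Proof.
move=> /and5P[_ _ _ /forallP tu_a /forallP tu_b] xB; apply: expR_near.
have -> : eps * (1 + B *+ d) = eps * B *+ d + eps.
  by rewrite mulrDr -mulrnAr; ring.
rewrite opprD addrACA; apply: le_trans (ler_normD _ _) _; rewrite lerD//.
  apply: dotv_near => // i; rewrite !mxE.
  by move: (tu_a i) => /forallP.
by move: (tu_b s) => /forallP.
Qed.

Lemma mx_near_sym m n eps : symmetric (@mx_near m n eps).
Proof.
by move=> A B; apply: eq_forallb => i; apply: eq_forallb => j; rewrite distrC.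
Qed.

Lemma param_near_sym eps : symmetric (param_near eps).
Proof.
move=> t u; rewrite /param_near (distrC (gamma t)) (distrC (beta t)).
by rewrite (mx_near_sym _ (alpha t)) (mx_near_sym _ (expert_a t)) (mx_near_sym _ (expert_b t)).
Qed.

Lemma all2_sym T (r : rel T) : symmetric r -> symmetric (all2 r).
Proof. by move=> rs; elim=> [|x s IH] [|y t] //=; rewrite rs IH. Qed.

Lemma ler_sum_all2 (T : Type) (r : rel T) (F G : T -> R) s t :
  all2 r s t -> (forall x y, r x y -> F x <= G y) ->
  \sum_(x <- s) F x <= \sum_(y <- t) G y.
Proof.
move=> + FG; elim: s t => [|x s IH] [|y t] //=; first by rewrite !big_nil.
by move=> /andP[xy st]; rewrite !big_cons lerD ?FG ?IH.
Qed.

(** One factor [exp c] is lost in the numerator and one in the denominator, whose comparison runs in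
    the opposite direction. *)
Lemma ler_ratio_perturb (c w W w' W' : R) :
  0 < W -> 0 < W' -> 0 < w' ->
  w <= expR c * w' -> W' <= expR c * W -> w / W <= expR (c *+ 2) * (w' / W').
Proof.
move=> W0 W'0 w'0 ww' W'W; rewrite ler_pdivrMr// mulrAC mulrA ler_pdivlMr//.
rewrite mulr2n expRD.
have := ler_pM (ltW (mulr_gt0 (expR_gt0 c) w'0)) (ltW W'0) (lexx (expR c * w')) W'W.
move=> h; apply: le_trans (_ : expR c * w' * W' <= _).
  by rewrite ler_wpM2r// ltW.
by apply: le_trans h _; rewrite le_eqVlt; apply/orP; left; apply/eqP; ring.
Qed.

Lemma cond_density_near (eps B : R) (G H : mixing R d K') (x : 'cV[R]_d) s :
  (0 < size G)%N -> (0 < size H)%N ->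
  all2 (param_near eps) G H -> (forall i, `|x i ord0| <= B) ->
  cond_density G x s <= expR (eps * (6 + (B *+ d) *+ 4)) * cond_density H x s.
Proof.
move=> G0 H0 GH xB; rewrite /cond_density mulr_sumr.
have HG : all2 (param_near eps) H G by rewrite all2_sym//; exact: param_near_sym.
have W : \sum_(u <- H) gate_weight u x <=
    expR (eps * (2 + B *+ d)) * \sum_(u <- G) gate_weight u x.
  by rewrite mulr_sumr; apply: ler_sum_all2 HG _ => t u tu; exact: gate_weight_near.
apply: ler_sum_all2 GH _ => t u tu.
(* Each summand is a gate ratio times a softmax ratio, and each ratio costs twice its exponent:
   [6 + 4 B d = 2 (2 + B d) + 2 (1 + B d)]. *)
have -> : eps * (6 + (B *+ d) *+ 4) =
    (eps * (2 + B *+ d)) *+ 2 + (eps * (1 + B *+ d)) *+ 2 by ring.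
rewrite expRD [leRHS]mulrACA; apply: ler_pM.
- by rewrite divr_ge0 ?ltW ?gate_weight_gt0 ?sum_gate_weight_gt0.
- by rewrite divr_ge0 ?ltW ?expert_score_gt0 ?sum_expert_score_gt0.
- apply: ler_ratio_perturb => //; rewrite ?gate_weight_gt0 ?sum_gate_weight_gt0//.
  exact: gate_weight_near.
- apply: ler_ratio_perturb => //; rewrite ?expert_score_gt0 ?sum_expert_score_gt0//.
    exact: expert_score_near.
  rewrite mulr_sumr; apply: ler_sum => l _.
  by apply: expert_score_near => //; rewrite param_near_sym.
Qed.
End parameter_perturbation.

(** * Polynomial covering numbers *)

Section polynomial_covering.

(** [near n] stands for closeness at scale [1 / n]. The constants [C] and [D] serve all [n], and the
    points of the net may lie outside [A]. *)
Definition poly_cover (T : eqType) (A : T -> Prop) (near : nat -> rel T) :=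
  exists C D : nat, forall n, (0 < n)%N ->
    exists2 s : seq T, (size s <= C * n ^ D)%N &
      forall x, A x -> exists2 y, y \in s & near n x y.

Lemma poly_cover_prod (T U : eqType) (A : T -> Prop) (B : U -> Prop) near near' :
  poly_cover A near -> poly_cover B near' ->
  poly_cover (fun x : T * U => A x.1 /\ B x.2)
    (fun n x y => near n x.1 y.1 && near' n x.2 y.2).
Proof.
move=> [C [D cA]] [C' [D' cB]]; exists (C * C')%N, (D + D')%N => n n0.
have [s ss As] := cA _ n0; have [s' ss' Bs'] := cB _ n0.
exists [seq (x, y) | x <- s, y <- s'] => [|[x y] [/= Ax By]].
  by rewrite size_allpairs expnD mulnACA leq_mul.
have [x' x's nx] := As _ Ax; have [y' y's' ny] := Bs' _ By.
by exists (x', y'); [exact: allpairs_f | rewrite /= nx ny].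
Qed.

Lemma poly_cover_seq (T : eqType) (A : T -> Prop) near k :
  poly_cover A near ->
  poly_cover (fun s : seq T => (size s <= k)%N /\ forall x, x \in s -> A x)
    (fun n => all2 (near n)).
Proof.
move=> [C [D cA]]; elim: k => [|k [C' [D' IH]]].
  exists 1%N, 0%N => n n0; exists [:: [::]] => // -[|x s] [//= _ _].
  by exists [::]; rewrite ?inE.
(* The summand 1 pays for the empty list, since [n ^ (D + D') >= 1]; the other lists are a head from
   one net followed by a tail from the other. *)
exists (1 + C * C')%N, (D + D')%N => n n0.
have [s ss As] := cA _ n0; have [s' ss' IHs'] := IH _ n0.
exists ([::] :: [seq x :: y | x <- s, y <- s']) => [|[|x y] [/= xyk xyA]].
- rewrite /= size_allpairs mulnDl mul1n -add1n leq_add ?expn_gt0 ?n0//.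
  by rewrite expnD mulnACA leq_mul.
- by exists [::].
- have [x' x's nx] : exists2 x', x' \in s & near n x x'.
    by apply: As; apply: xyA; rewrite mem_head.
  have [y' y's' ny] : exists2 y', y' \in s' & all2 (near n) y y'.
    by apply: IHs'; split => // z zy; apply: xyA; rewrite inE zy orbT.
  exists (x' :: y'); last by rewrite /= nx.
  by rewrite inE; apply/orP; right; exact: allpairs_f.
Qed.

(** A net matrix picks a point of the scalar net for each entry, so there are [size s ^ (m1 * m2)]
    choices. Indices in ['I_(size s)] are in range, so the default [r0] of [nth] is never
    reached. *)
Lemma poly_cover_mx (R : eqType) (r0 : R) (A : R -> Prop) near m1 m2 :
  poly_cover A near ->
  poly_cover (fun M : 'M[R]_(m1, m2) => forall i j, A (M i j))
    (fun n M N => [forall i, forall j, near n (M i j) (N i j)]).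
Proof.
move=> [C [D cA]]; exists (C ^ (m1 * m2))%N, (D * (m1 * m2))%N => n n0.
have [s ss As] := cA _ n0.
exists [seq \matrix_(i, j) nth r0 s (f (i, j))
       | f : {ffun 'I_m1 * 'I_m2 -> 'I_(size s)}] => [|M AM].
  rewrite size_map -cardE card_ffun card_prod !card_ord (expnM n) -expnMn.
  (* A matrix without entries gives 1 on both sides; [leq_exp2r] handles positive exponents. *)
  by case: (m1 * m2)%N => // e; rewrite leq_exp2r.
have /boolp.choice [g gP] (p : 'I_m1 * 'I_m2) :
    exists k : 'I_(size s), near n (M p.1 p.2) (nth r0 s k).
  have [y ys ny] := As _ (AM p.1 p.2).
  have ilt : (index y s < size s)%N by rewrite index_mem.
  by exists (Ordinal ilt); rewrite /= nth_index.
exists (\matrix_(i, j) nth r0 s ([ffun p => g p] (i, j))).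
  by apply/mapP; exists [ffun p => g p] => //; rewrite mem_enum.
by apply/forallP => i; apply/forallP => j; rewrite mxE ffunE; exact: gP (i, j).
Qed.

Lemma poly_cover_itv (R : realType) (B : nat) :
  poly_cover (fun x : R => `|x| <= B%:R) (fun n x y => `|x - y| <= n%:R^-1).
Proof.
(* The grid of step [1 / n] on [[-B, B]] has [2 B n + 1 <= (2 B + 1) n] points; [x] is rounded down
   to it. *)
exists (2 * B).+1, 1%N => n n0.
have n0' : 0 < n%:R :> R by rewrite ltr0n.
exists [seq j%:R / n%:R - B%:R | j <- iota 0 (2 * B * n).+1] => [|x xB].
  by rewrite size_map size_iota expn1 mulSn -add1n leq_add2r.
move: xB; rewrite ler_norml => /andP[Bx xB].
have y0 : 0 <= (x + B%:R) * n%:R by rewrite mulr_ge0 ?(ltW n0')// -lerBlDr sub0r.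
have /andP[jy yj] := truncn_itv y0; set j := Num.truncn _ in jy yj.
exists (j%:R / n%:R - B%:R).
  apply/mapP; exists j => //; rewrite mem_iota leq0n add0n ltnS -(ler_nat R).
  apply: le_trans jy _; rewrite natrM ler_pM2r// natrM.
  by move: xB; lra.
move: jy yj; rewrite -ler_pdivrMr// -ltr_pdivlMr// -addn1 natrD mulrDl div1r => jy yj.
by rewrite ler_norml; apply/andP; split; [have : 0 <= n%:R^-1 :> R by rewrite invr_ge0 ler0n | ]; lra.
Qed.

End polynomial_covering.

(** * Covering the mixture class *)

Section class_covering.
Context {R : realType} {d K' : nat}.

Lemma poly_cover_param (B : nat) :
  poly_cover (fun t : param R d K' =>
      [/\ `|gamma t| <= B%:R, forall i j, `|alpha t i j| <= B%:R,
          `|beta t| <= B%:R, forall i j, `|expert_a t i j| <= B%:R &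
          forall i j, `|expert_b t i j| <= B%:R])
    (fun n => param_near n%:R^-1).
Proof.
have cR := @poly_cover_itv R B.
have cM m1 m2 := @poly_cover_mx R 0 _ _ m1 m2 cR.
(* The nesting follows the left-associated product [param]; vectors are matrices with one column. *)
have [C [D c]] := poly_cover_prod (poly_cover_prod (poly_cover_prod
  (poly_cover_prod cR (cM d 1%N)) cR) (cM d K'.+1)) (cM K'.+1 1%N).
exists C, D => n n0; have [s ss sP] := c _ n0; exists s => // t [tg ta tb tea teb].
have [u us] := sP t (conj (conj (conj (conj tg ta) tb) tea) teb).
by move=> /andP[/andP[/andP[/andP[? ?] ?] ?] ?]; exists u => //; apply/and5P.
Qed.

Lemma mx_entry_norm m n (M : 'M[R]_(m, n)) i j : `|M i j| <= `|M|.
Proof.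
rewrite [leRHS]/Num.Def.normr/= mx_normrE.
by apply/bigmax_geP; right => /=; exists (i, j).
Qed.

Lemma poly_cover_mixing_class (k : nat) (Theta : set (param R d K')) :
  compact Theta ->
  poly_cover (mixing_class k Theta) (fun n => all2 (param_near n%:R^-1)).
Proof.
move=> /compact_bounded [b [_ bP]].
(* A natural number strictly above [b], as boundedness demands; it bounds every coordinate on
   [Theta]. *)
pose B := (Num.truncn `|b|).+1.
have bB : b < B%:R.
  by rewrite (le_lt_trans (ler_norm b))// truncnS_gt.
have [C [D c]] := poly_cover_seq k (poly_cover_param B).
exists C, D => n n0; have [s ss sP] := c _ n0; exists s => // G [/andP[_ Gk] GT].
apply: sP; split => // t tG.
have /= := bP _ bB _ (GT _ tG); rewrite !prod_normE !ge_max.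
move=> /andP[/andP[/andP[/andP[tg ta] tb] tea] teb].
by split=> // i j; apply: le_trans (mx_entry_norm _ _ _) _.
Qed.
End class_covering.

(** * Chernoff's bound and the Hellinger distance *)

Section chernoff.
Context {R : realType}.

Lemma measurable_sqrt d1 (T : measurableType d1) (f : T -> R) :
  measurable_fun [set: T] f -> measurable_fun [set: T] (fun x => Num.sqrt (f x)).
Proof.
move=> mf; apply: measurableT_comp mf.
by apply: continuous_measurable_fun; exact: sqrt_continuous.
Qed.

Lemma integrable_bounded_prob d1 (T : measurableType d1) (m : probability T R)
    (f : T -> R) (c : R) :
  measurable_fun [set: T] f -> (forall x, `|f x| <= c) ->
  m.-integrable [set: T] (EFin \o f).
Proof.
move=> mf fc; apply: (@le_integrable _ _ _ m _ measurableT _ (EFin \o cst c)).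
- exact/measurable_EFinP.
- by move=> x _ /=; rewrite lee_fin (le_trans (fc x))// ler_norm.
- exact: finite_measure_integrable_cst.
Qed.

Lemma Rintegral_cst_prob d1 (T : measurableType d1) (m : probability T R) (c : R) :
  (\int[m]_(x in [set: T]) c)%R = c.
Proof.
rewrite Rintegral_cst// [X in _ * X](_ : _ = 1) ?mulr1//.
exact: (congr1 fine (@probability_setT _ _ _ m)).
Qed.

Lemma measurable_hellinger d1 (T : measurableType d1) K'
    (p q : T -> 'I_K'.+1 -> R) :
  (forall s, measurable_fun [set: T] (p ^~ s)) ->
  (forall s, measurable_fun [set: T] (q ^~ s)) ->
  measurable_fun [set: T] (fun x => hellinger (p x) (q x)).
Proof.
move=> mp mq; apply: measurable_sqrt; apply: measurable_funM => //.
apply: measurable_sum => s; apply: measurable_funX.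
by apply: measurable_funB; apply: measurable_sqrt.
Qed.

Lemma markov_ge0 d1 (T : measurableType d1) (m : probability T R) (f : T -> R) (c : R) :
  0 < c -> measurable_fun [set: T] f -> (forall x, 0 <= f x) ->
  (m [set x | (c <= f x)%R] <= (c^-1)%:E * \int[m]_x (f x)%:E)%E.
Proof.
move=> c0 mf f0.
have mA : measurable [set x | c <= f x].
  have -> : [set x | c <= f x] = f @^-1` `[c, +oo[.
    by apply/seteqP; split => x /=; rewrite in_itv/= andbT.
  by rewrite -[X in measurable X]setTI; apply: mf.
rewrite lee_pdivlMl// -[X in m X]setIT -integral_indic// -ge0_integralZl//; last 2 first.
- by apply/measurable_EFinP; exact: measurable_indic.
- by rewrite lee_fin ltW.
apply: ge0_le_integral => //.
- by move=> x _; rewrite mule_ge0// lee_fin ltW.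
- by apply: emeasurable_funM => //; apply/measurable_EFinP; exact: measurable_indic.
- exact/measurable_EFinP.
- move=> x _; rewrite -EFinM lee_fin indicE.
  by case: (boolP (x \in _)) => [/set_mem/= cfx|_]; rewrite ?mulr1 ?mulr0.
Qed.

End chernoff.

(** * Mean squared Hellinger distance *)

Section likelihood_ratio.
Context {R : realType} {d K' : nat}.
Implicit Types G H : mixing R d K'.
Variable mu : probability (borel_cV R d) R.

Definition mean_hellinger_sqr G H : R :=
  (\int[mu]_x (hellinger (cond_density G x) (cond_density H x)) ^+ 2)%R.

Lemma measurable_hellinger_sqr G H : (0 < size G)%N -> (0 < size H)%N ->
  measurable_fun [set: borel_cV R d]
    (fun x => hellinger (cond_density G x) (cond_density H x) ^+ 2).
Proof.
move=> G0 H0; apply: measurable_funX.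
by apply: measurable_hellinger => s; exact: measurable_cond_density.
Qed.

Lemma hellinger_cond_density_le1 G H x : (0 < size G)%N -> (0 < size H)%N ->
  hellinger (cond_density G x) (cond_density H x) <= 1.
Proof.
move=> G0 H0; apply: hellinger_le1; rewrite ?sum_cond_density// => s;
  exact/ltW/cond_density_gt0.
Qed.

Lemma integrable_hellinger_sqr G H : (0 < size G)%N -> (0 < size H)%N ->
  mu.-integrable [set: borel_cV R d]
    (EFin \o (fun x => hellinger (cond_density G x) (cond_density H x) ^+ 2)).
Proof.
move=> G0 H0; apply: (@integrable_bounded_prob _ _ _ _ _ 1).
  exact: measurable_hellinger_sqr.
move=> x; rewrite ger0_norm ?sqr_ge0// expr_le1// ?hellinger_ge0//.
exact: hellinger_cond_density_le1.
Qed.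

Lemma affinity_mean G H : (0 < size G)%N -> (0 < size H)%N ->
  (\int[mu]_x (\sum_s Num.sqrt (cond_density G x s * cond_density H x s))%:E)%E =
  (1 - mean_hellinger_sqr G H)%:E.
Proof.
move=> G0 H0.
transitivity (\int[mu]_x (1 - hellinger (cond_density G x) (cond_density H x) ^+ 2)%:E)%E.
  apply: eq_integral => x _; congr EFin; rewrite hellinger_sqr ?sum_cond_density//; last 2 first.
  - by move=> s; exact/ltW/cond_density_gt0.
  - by move=> s; exact/ltW/cond_density_gt0.
  by rewrite subKr.
have i1 : mu.-integrable [set: borel_cV R d] (EFin \o cst 1).
  exact: finite_measure_integrable_cst.
have ih := integrable_hellinger_sqr G0 H0.
rewrite -[LHS]fineK; last first.
  apply: integrable_fin_num => //.
  exact: integrableB i1 ih.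
rewrite -/(Rintegral _ _ _) RintegralB// Rintegral_cst_prob.
by [].
Qed.

(** Pointwise [h <= (h^2 / r + r) / 2], and [hellinger_sqr_perturb] replaces [G] by [H] at cost
    [c / 2]. An almost everywhere comparison is what a bounded covariate provides. *)
Lemma expected_hellinger_le G H Gs (c r : R) :
  (0 < size G)%N -> (0 < size H)%N -> (0 < size Gs)%N -> 0 <= c -> 0 < r ->
  {ae mu, forall x, forall s, cond_density H x s <= expR c * cond_density G x s} ->
  expected_hellinger mu G Gs <=
    ((c / 2 + mean_hellinger_sqr H Gs) / r + r) / 2.
Proof.
move=> G0 H0 Gs0 c0 r0 GH.
have ih := integrable_hellinger_sqr H0 Gs0.
(* The bound is the integral of [k + b h'^2], where [h'] is the distance from [H] to [Gs]. *)
set k : R := (c / 2 / r + r) / 2; set b : R := (2 * r)^-1.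
have b0 : 0 < b by rewrite invr_gt0 mulr_gt0.
have k0 : 0 <= k by rewrite divr_ge0// addr_ge0// ?divr_ge0// ltW.
have ik : mu.-integrable [set: borel_cV R d] (EFin \o cst k).
  exact: finite_measure_integrable_cst.
have ibh : mu.-integrable [set: borel_cV R d] (EFin \o
    (fun x => b * hellinger (cond_density H x) (cond_density Gs x) ^+ 2)).
  exact: integrableZl ih.
have -> : ((c / 2 + mean_hellinger_sqr H Gs) / r + r) / 2 =
    (\int[mu]_x (k + b * hellinger (cond_density H x) (cond_density Gs x) ^+ 2))%R.
  rewrite RintegralD// Rintegral_cst_prob RintegralZl//.
  by rewrite /mean_hellinger_sqr /k /b; field; rewrite gt_eqF.
have ih0 : mu.-integrable [set: borel_cV R d] (EFin \o
    (fun x => hellinger (cond_density G x) (cond_density Gs x))).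
  apply: (@integrable_bounded_prob _ _ _ _ _ 1).
    by apply: measurable_hellinger => s; exact: measurable_cond_density.
  by move=> x; rewrite ger0_norm ?hellinger_ge0// hellinger_cond_density_le1.
have ikbh : mu.-integrable [set: borel_cV R d] (EFin \o
    (fun x => k + b * hellinger (cond_density H x) (cond_density Gs x) ^+ 2)).
  exact: integrableD ik ibh.
rewrite /expected_hellinger /Rintegral; apply: fine_le.
- exact: integrable_fin_num ih0.
- exact: integrable_fin_num ikbh.
apply: ae_ge0_le_integral => //.
- by move=> x _; rewrite lee_fin hellinger_ge0.
- exact: measurable_int ih0.
- by move=> x _; rewrite lee_fin addr_ge0// mulr_ge0 ?sqr_ge0// ltW.
- exact: measurable_int ikbh.
case: GH => N [mN N0 GHN]; exists N; split => //.
apply: subset_trans GHN; apply: subsetC => x /= GH _; rewrite lee_fin.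
have := @hellinger_sqr_perturb _ _ c (cond_density G x) (cond_density H x)
  (cond_density Gs x); rewrite !sum_cond_density// => /(_ _ _ _ erefl erefl erefl c0 GH).
have cd0 (F : mixing R d K') s : (0 < size F)%N -> 0 <= cond_density F x s.
  by move=> F0; exact/ltW/cond_density_gt0.
move=> /(_ (fun s => cd0 G s G0) (fun s => cd0 H s H0) (fun s => cd0 Gs s Gs0)).
set h := hellinger _ _; set h' := hellinger _ _ => hh'.
have h2 : 2 * r * h <= h ^+ 2 + r ^+ 2 by have := sqr_ge0 (h - r); lra.
have -> : k + b * h' ^+ 2 = (c / 2 + h' ^+ 2 + r ^+ 2) / (2 * r).
  by rewrite /k /b; field; rewrite gt_eqF.
by rewrite ler_pdivlMr ?mulr_gt0// mulrC; lra.
Qed.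

End likelihood_ratio.

(** * Tail of the likelihood ratio *)

Section chernoff_bound.
Context {R : realType} {d K' : nat}.

Lemma sqrtr_ratioE (a b : R) : 0 < a -> 0 < b ->
  Num.sqrt (a / b) = expR ((ln a - ln b) / 2).
Proof.
move=> a0 b0; rewrite -[in LHS](lnK a0) -[in LHS](lnK b0) -expRN -expRD.
by rewrite {1}[ln a - ln b]splitr expRD -expr2 sqrtr_sqr ger0_norm// expR_ge0.
Qed.

(* Chernoff at exponent 1/2: the expectation of [sqrt (p_H / p_Gs)] under
   [p_Gs] is the Hellinger affinity [1 - h^2 <= exp (- h^2)]. *)
Lemma likelihood_ratio_tail dO (Omega : measurableType dO)
    (P : probability Omega R) (mu : probability (borel_cV R d) R)
    (Gs H : mixing R d K') (Z : nat -> {RV P >-> (borel_cV R d * 'I_K'.+1)%type})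
    (n : nat) (L : R) :
  (0 < size Gs)%N -> (0 < size H)%N ->
  mutually_independent P Z ->
  (forall i, has_law P mu (cond_density Gs) (Z i)) ->
  ((P^*)%mu [set w | (- L <= log_likelihood n (fun i => Z i w) H -
                           log_likelihood n (fun i => Z i w) Gs)%R] <=
   (expR (L / 2 - n%:R * mean_hellinger_sqr mu H Gs))%:E)%E.
Proof.
move=> Gs0 H0 indep law.
pose f (z : borel_cV R d * 'I_K'.+1) : R :=
  Num.sqrt (cond_density H z.1 z.2 / cond_density Gs z.1 z.2).
have f0 z : 0 <= f z by exact: sqrtr_ge0.
have mf1 s : measurable_fun [set: borel_cV R d] (fun x => f (x, s)).
  apply: measurable_sqrt; apply: measurable_funM.
    exact: measurable_cond_density.
  apply: measurable_funV_gt0; last exact: measurable_cond_density.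
  by move=> x; exact: cond_density_gt0.
have mf : measurable_fun [set: (borel_cV R d * 'I_K'.+1)%type] f.
  exact: measurable_fun_snd_ord.
have Ef i : (\int[P]_w (f (Z i w))%:E = (1 - mean_hellinger_sqr mu H Gs)%:E)%E.
  rewrite (expectation_has_law (law i))//; last 2 first.
  - by move=> s; exact: measurable_cond_density.
  - by move=> x s; exact/ltW/cond_density_gt0.
  rewrite -affinity_mean//; apply: eq_integral => x _; congr EFin.
  apply: eq_bigr => s _; rewrite /f /=.
  have q0 := cond_density_gt0 x s Gs0; have p0 := cond_density_gt0 x s H0.
  (* The weight is written as the square of its root: one root cancels the denominator, the other
     completes the affinity. *)
  rewrite -{2}[cond_density Gs x s]sqr_sqrtr ?(ltW q0)// expr2 mulrA -sqrtrM; last first.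
    by rewrite divr_ge0// ltW.
  by rewrite divfK ?gt_eqF// -sqrtrM// ltW.
(* Nonnegativity lets [1 - h^2 <= exp (- h^2)] be raised to the power [n] at the end. *)
have affinity0 : 0 <= 1 - mean_hellinger_sqr mu H Gs.
  by rewrite -lee_fin -(Ef 0%N) integral_ge0// => w _; rewrite lee_fin.
pose W w := \prod_(0 <= i < n) f (Z i w).
have mW : measurable_fun [set: Omega] W.
  apply: measurable_prod => i _; apply: (measurableT_comp mf).
  exact: measurable_funPT.
have W0 w : 0 <= W w by exact: prodr_ge0.
have WE w : W w = expR ((log_likelihood n (fun i => Z i w) H -
                         log_likelihood n (fun i => Z i w) Gs) / 2).
  rewrite /W /log_likelihood -sumrB mulr_suml expR_sum -(big_mkord xpredT
    (fun i => expR ((ln (cond_density H (Z i w).1 (Z i w).2) -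
                     ln (cond_density Gs (Z i w).1 (Z i w).2)) / 2))).
  apply: eq_bigr => i _.
  by rewrite /f sqrtr_ratioE// cond_density_gt0.
set A := [set w | _].
(* For a fixed [H] the event is measurable, so its outer measure is its probability and Markov's
   inequality applies to [W]. *)
have -> : A = [set w | expR (- L / 2) <= W w].
  apply/seteqP; split => w /=; rewrite WE ler_expR ler_pM2r ?invr_gt0//.
have mA : measurable [set w | expR (- L / 2) <= W w].
  rewrite (_ : mkset _ = W @^-1` `[expR (- L / 2), +oo[); last first.
    by apply/seteqP; split => w /=; rewrite in_itv/= andbT.
  by rewrite -[X in measurable X]setTI; exact: mW.
rewrite measurable_mu_extE//.
apply: le_trans (markov_ge0 _ (expR_gt0 (- L / 2)) mW W0) _.
rewrite /W (@expectation_prod_independent _ _ _ _ _ _ _ (fun=> f))//; last 2 first.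
- exact: iota_uniq.
- by move=> i; rewrite Ef ltry.
under eq_bigr do rewrite Ef.
rewrite prodEFin -EFinM lee_fin -expRN prodr_const_nat subn0.
rewrite (_ : L / 2 - _ = - (- L / 2) + n%:R * (- mean_hellinger_sqr mu H Gs)); last by ring.
rewrite expRD expRM_natl ler_pM2l ?expR_gt0//.
apply: lerXn2r; rewrite ?nnegrE ?expR_ge0//.
exact: expR_ge1Dx.
Qed.

(** Union bound by finite subadditivity, for outer measures because [bigO_P] is stated with
    [P^*]. *)
Lemma outer_measure_bigsetU (T : Type) (m : {outer_measure set T -> \bar R})
    (I : eqType) (s : seq I) (A : I -> set T) (b : R) :
  (forall i, i \in s -> (m (A i) <= b%:E)%E) ->
  (m (\big[setU/set0]_(i <- s) A i) <= ((size s)%:R * b)%:E)%E.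
Proof.
elim: s => [|i s IH] Ab; first by rewrite big_nil outer_measure0 mul0r.
rewrite big_cons /= -natr1 mulrDl mul1r addrC EFinD.
apply: le_trans (outer_measureU2 _ _ _) _; apply: leeD.
  by apply: Ab; rewrite mem_head.
by apply: IH => j js; apply: Ab; rewrite inE js orbT.
Qed.

(** Each of the [n] log-densities moves by at most [c]; with [c = l / n] the total loss [l] does not
    grow with [n]. *)
Lemma log_likelihood_perturb n (z : nat -> 'cV[R]_d * 'I_K'.+1) (c : R)
    (G H : mixing R d K') : (0 < size G)%N -> (0 < size H)%N ->
  (forall i, cond_density G (z i).1 (z i).2 <= expR c * cond_density H (z i).1 (z i).2) ->
  log_likelihood n z G <= n%:R * c + log_likelihood n z H.
Proof.
move=> G0 H0 GH; rewrite /log_likelihood.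
have -> : n%:R * c = \sum_(i < n) c by rewrite sumr_const card_ord mulr_natl.
rewrite -big_split/=; apply: ler_sum => i _.
rewrite -[X in X + _]expRK -lnM ?posrE ?expR_gt0 ?cond_density_gt0//.
by rewrite ler_ln ?posrE ?mulr_gt0 ?expR_gt0 ?cond_density_gt0.
Qed.

(** The size [n ^ D] of the net against the tail [n ^ - (D + 1)] of one element: the extra degree
    makes the union bound vanish. *)
Lemma natrX_mul_expRN_ln (n D : nat) : (0 < n)%N ->
  n%:R ^+ D * expR (- (D.+1%:R * ln n%:R)) = n%:R^-1 :> R.
Proof.
move=> n0; have n0' : 0 < n%:R :> R by rewrite ltr0n.
rewrite expRN expRM_natl lnK ?posrE// exprS invfM mulrCA mulfV ?mulr1//.
by rewrite expf_neq0// gt_eqF.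
Qed.

End chernoff_bound.

(** * The convergence rate of the maximum likelihood estimator *)

Theorem proposition2 (R : realType) (dO : measure_display)
    (Omega : measurableType dO) (P : probability Omega R)
    (d K' k kstar : nat)
    (Theta : set (param R d K')) (Xspace : set 'cV[R]_d)
    (mu : probability (borel_cV R d) R)
    (Gstar : kstar.-tuple (param R d K'))
    (Z : nat -> {RV P >-> (borel_cV R d * 'I_K'.+1)%type})
    (Ghat : nat -> Omega -> mixing R d K')
    (k_gt : (kstar < k)%N)
    (Gstar_Theta : forall i, Theta (tnth Gstar i))
    (* (A.1) *)
    (Theta_compact : compact Theta)
    (Xspace_bounded : bounded_set Xspace)
    (* (A.2) *)
    (experts_distinct : injective (fun i : 'I_kstar =>
       (expert_a (tnth Gstar i), expert_b (tnth Gstar i))))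
    (* (A.3) *)
    (experts_last : forall i : 'I_kstar,
       col ord_max (expert_a (tnth Gstar i)) = 0 /\
       expert_b (tnth Gstar i) ord_max ord0 = 0)
    (gamma_last : forall i : 'I_kstar,
       i.+1 = kstar -> gamma (tnth Gstar i) = 0)
    (* (A.4) *)
    (alpha_neq0 : exists i : 'I_kstar, alpha (tnth Gstar i) <> 0)
    (Z_Xspace : forall i w, Xspace (Z i w).1)
    (Z_indep : mutually_independent P Z)
    (Z_law : forall i, has_law P mu (cond_density Gstar) (Z i))
    (Ghat_mle : forall n w, is_mle k Theta n (fun i => Z i w) (Ghat n w)) :
  bigO_P P
    (fun n w => expected_hellinger mu (Ghat n w) Gstar)
    (fun n => Num.sqrt ((K'.+1 * d * k)%:R * ln n%:R / n%:R)).
Proof.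
have [i0 alpha_i0] := alpha_neq0.
have kstar0 : (0 < kstar)%N by apply: leq_ltn_trans (ltn_ord i0).
(* In dimension 0 every vector is zero, so (A.4) gives [d > 0]. Hence [kappa >= 1], and [ln n / n]
   is at most the squared rate. *)
have d0 : (0 < d)%N.
  rewrite lt0n; apply/eqP => d0; apply: alpha_i0; apply/matrixP => i.
  by have := ltn_ord i; rewrite {2}d0.
have kappa1 : 1 <= (K'.+1 * d * k)%:R :> R.
  by rewrite ler1n !muln_gt0 d0 /= (leq_ltn_trans _ k_gt).
set kappa : R := (K'.+1 * d * k)%:R in kappa1 *.
have Gs0 : (0 < size Gstar)%N by rewrite size_tuple.
have Gs_class : mixing_class k Theta Gstar.
  split; first by rewrite size_tuple kstar0 ltnW.
  by move=> t /tnthP[i ->].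
have [M0 [_ XM0]] := Xspace_bounded.
pose B := `|M0| + 1.
have XB x : Xspace x -> `|x| <= B.
  by apply: XM0; rewrite (le_lt_trans (ler_norm M0))// ltrDl.
have B0 : 0 <= B by rewrite addr_ge0.
(* [Xspace] may fail to be measurable; a closed ball containing it is measurable and carries the law
   [mu]. *)
pose ball_B : set (borel_cV R d) := [set x : 'cV[R]_d | `|x| <= B].
have mball_B : measurable ball_B.
  have : measurable_fun [set: borel_cV R d] (fun x : 'cV[R]_d => `|x|).
    by apply: continuous_measurable_borel; exact: norm_continuous.
  move=> /(_ measurableT _ (measurable_itv `]-oo, B])); rewrite setTI.
  by congr measurable; apply/seteqP; split => x /=; rewrite in_itv.
have mu_ball_B : mu ball_B = 1%E.
  rewrite -(Z_law 0%N).1// -(@probability_setT _ _ _ P); congr (P _).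
  by apply/seteqP; split => w //= _; exact/XB/Z_Xspace.
have aeB : {ae mu, forall x : 'cV[R]_d, `|x| <= B}.
  exists (~` ball_B); split; first exact: measurableC.
    by rewrite probability_setC// mu_ball_B subee.
  exact: subsetC.
(* The constant of [cond_density_near]: closeness [1 / n] of parameters gives a density ratio of at
   most [exp (l / n)]. *)
pose l : R := 6 + (B *+ d) *+ 4.
have l0 : 0 <= l by rewrite addr_ge0// !mulrn_wge0.
have [C [D cover]] := poly_cover_mixing_class k Theta_compact.
(* In [D + 2], the part [D + 1] is the threshold on [h^2] in [S'] and 1 comes from the term [r] of
   [expected_hellinger_le]; [l] absorbs the error of the net. *)
move=> eps eps0; exists ((D.+2%:R + l) / 2).
  by rewrite divr_gt0// ltr_pwDl// ltr0n.
near=> n.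
have n1 : expR 1 < n%:R :> R by near: n; exact: nbhs_infty_gtr.
have nC : C%:R * expR (l / 2) / eps < n%:R by near: n; exact: nbhs_infty_gtr.
have n0 : 0 < n%:R :> R by apply: lt_trans n1; exact: expR_gt0.
have ln_n1 : 1 <= ln n%:R :> R by rewrite -ler_expR lnK ?posrE// ltW.
have [S sizeS coverS] := cover n (ltac:(by rewrite -(ltr0n R))).
(* The net elements far from the truth; [A H] is the event that such an [H] nevertheless has a
   likelihood close to that of the truth. *)
pose S' := [seq H <- S | (0 < size H)%N &&
  (D.+1%:R * (ln n%:R / n%:R) < mean_hellinger_sqr mu H Gstar)].
pose A H := [set w | - l <= log_likelihood n (fun i => Z i w) H -
                            log_likelihood n (fun i => Z i w) Gstar].
set r := Num.sqrt _.
have r2 : r ^+ 2 = kappa * ln n%:R / n%:R.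
  by rewrite sqr_sqrtr// divr_ge0 ?mulr_ge0// ?(le_trans _ kappa1) ?(le_trans _ ln_n1)// ltW.
have r0 : 0 < r.
  by rewrite sqrtr_gt0 divr_gt0 ?mulr_gt0// ?(lt_le_trans _ kappa1) ?(lt_le_trans _ ln_n1).
have sub : [set w | ((D.+2%:R + l) / 2 < expected_hellinger mu (Ghat n w) Gstar / r)%R]
    `<=` \big[setU/set0]_(H <- S') A H.
  move=> w /=; rewrite ltr_pdivlMr// => Mr.
  have [[/andP[Ghat0 Ghatk] GhatT] mle] := Ghat_mle n w.
  have [H HS near_GH] := coverS (Ghat n w) (conj (introT andP (conj Ghat0 Ghatk)) GhatT).
  (* A net element need not belong to the class, but [all2] forces it to have the length of the
     MLE. *)
  have H0 : (0 < size H)%N.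
    by move: near_GH Ghat0; case: (Ghat n w) => // t G; case: H {HS}.
  have near_HG : all2 (param_near n%:R^-1) H (Ghat n w).
    by rewrite all2_sym//; exact: param_near_sym.
  have cE : n%:R * (n%:R^-1 * l) = l by rewrite mulVKf ?gt_eqF.
  have ratio (F F' : mixing R d K') (x : 'cV[R]_d) s : (0 < size F)%N -> (0 < size F')%N ->
      all2 (param_near n%:R^-1) F F' -> `|x| <= B ->
      cond_density F x s <= expR (n%:R^-1 * l) * cond_density F' x s.
    move=> F0 F'0 FF' xB; apply: cond_density_near => // i.
    exact: le_trans (mx_entry_norm _ _ _) xB.
  (* The truth lies in the class, so the MLE does at least as well; passing to the neighbour [H]
     loses at most [l]. *)
  have ll : - l <= log_likelihood n (fun i => Z i w) H -
                   log_likelihood n (fun i => Z i w) Gstar.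
    have := @log_likelihood_perturb _ _ _ n (fun i => Z i w) (n%:R^-1 * l) _ _ Ghat0 H0
      (fun i => ratio _ _ _ (Z i w).2 Ghat0 H0 near_GH (XB _ (Z_Xspace i w))).
    by have := mle _ Gs_class; rewrite cE; lra.
  rewrite -bigcup_seq; exists H => //=.
  rewrite mem_filter HS H0 /= andbT.
  have c0 : 0 <= n%:R^-1 * l by rewrite mulr_ge0// invr_ge0 ltW.
  have ae_ratio : {ae mu, forall x, forall s, cond_density H x s <=
      expR (n%:R^-1 * l) * cond_density (Ghat n w) x s}.
    case: aeB => N [mN N0 BN]; exists N; split => //; apply: subset_trans BN.
    by apply: subsetC => x xB s; exact: ratio.
  have := expected_hellinger_le Ghat0 H0 Gs0 c0 r0 ae_ratio.
  (* Clearing denominators leaves [(D + 1 + l) r^2 < l / (2 n) + h]. As [1 / n <= y <= r^2], this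
     gives [h > (D + 1) y], so [H] is in [S']. *)
  move=> /(lt_le_trans Mr); rewrite ltr_pdivlMr// -ltrBlDr ltr_pdivlMr//.
  set h := mean_hellinger_sqr _ _ _; set y := ln n%:R / n%:R.
  have yr : y <= r ^+ 2.
    by rewrite r2 -mulrA ler_peMl// divr_ge0// ltW// (lt_le_trans _ ln_n1).
  have ny : n%:R^-1 <= y by rewrite ler_peMl// invr_ge0 ltW.
  have ly : n%:R^-1 * l <= l * y by rewrite mulrC ler_wpM2l.
  rewrite -(natr1 D.+1).
  have Dly : (D.+1%:R + l) * y <= (D.+1%:R + l) * r ^+ 2.
    by rewrite ler_wpM2l// addr_ge0.
  by move=> hlt; nra.
apply: le_lt_trans (le_mu_ext P sub) _.
(* For a far element [n h^2 > (D + 1) ln n], so Chernoff's bound is at most [exp (l / 2)] times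
   [n ^ - (D + 1)]. *)
have Ab H : H \in S' -> ((P^*)%mu (A H) <=
    (expR (l / 2) * expR (- (D.+1%:R * ln n%:R)))%:E)%E.
  rewrite mem_filter => /andP[/andP[H0 Hbig] _].
  apply: le_trans (likelihood_ratio_tail n l Gs0 H0 Z_indep Z_law) _.
  rewrite lee_fin -expRD ler_expR lerD2l lerN2.
  by move: Hbig; rewrite mulrA ltr_pdivrMr// [ltRHS]mulrC => /ltW.
apply: le_lt_trans (outer_measure_bigsetU Ab) _.
rewrite lte_fin.
(* At most [C n ^ D] events remain, with total mass at most [C exp (l / 2) / n], below [eps] by the
   choice [nC] of [n]. *)
apply: le_lt_trans (_ : (C * n ^ D)%:R * (expR (l / 2) * expR (- (D.+1%:R * ln n%:R))) < _).
  rewrite ler_wpM2r ?mulr_ge0 ?expR_ge0// ler_nat.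
  by rewrite (leq_trans _ sizeS)// size_filter count_size.
rewrite natrM natrX -mulrA [n%:R ^+ D * _]mulrCA natrX_mul_expRN_ln -?(ltr0n R)//.
by rewrite mulrA ltr_pdivrMr// [ltRHS]mulrC -ltr_pdivrMr.
Unshelve. all: by end_near. Qed.
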